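(* Let $\Sigma$ be a list of $r$ sign conditions for $\mathcal{P}_i = P_i,\dots,P_s$ ($1\le i\le s$) containing (possibly properly) all the feasible sign conditions for $\mathcal{P}_i$ on the finite set $Z$. Then the algorithm Auxlinsolve (described in the context), with input $\Sigma$ and the vector $\mathrm{TaQ}(\mathcal{P}_i^{\mathrm{Ada}(\Sigma)}, Z)$, outputs $c(\Sigma, Z)$, i.e. it solves the linear system $$\mathrm{Mat}(\mathrm{Ada}(\Sigma), \Sigma)\, c(\Sigma, Z) = \mathrm{TaQ}(\mathcal{P}_i^{\mathrm{Ada}(\Sigma)}, Z)$$ (with unknown vector $c(\Sigma,Z)$), within $2r^2$ operations in $\mathbb{Q}$.
   Context: **Setting.** $R$ is a real closed field, $Z \subset R^k$ is a finite set, $P_1,\dots,P_s \in R[X_1,\dots,X_k]$, and $\mathcal{P}_i$ is the list $P_i,\dots,P_s$. A sign condition for $\mathcal{P}_i$ is an element $\sigma$ of $\{0,1,-1\}^{\mathcal{P}_i}$, with coordinates $\sigma_j = \sigma(P_j)$, $j=i,\dots,s$. $c(\sigma,Z)$ is the number of $x\in Z$ with $\operatorname{sign}(P_j(x))=\sigma_j$ for $j=i,\dots,s$, and $\sigma$ is feasible on $Z$ if $c(\sigma,Z)>0$. For a list $\Sigma'=\sigma'_1,\dots,\sigma'_l$ of sign conditions, $c(\Sigma',Z)$ is the vector $(c(\sigma'_1,Z),\dots,c(\sigma'_l,Z))$. For a polynomial $P$, $\mathrm{TaQ}(P,Z) = \#\{x\in Z: P(x)>0\}-\#\{x\in Z: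 P(x)<0\}$. Lists of sign conditions have pairwise distinct entries and are ordered lexicographically using $0\prec 1\prec -1$, up to the reordering described below. **Sublists.** For a sign condition $\sigma$ for $\mathcal{P}_i$, $i<s$, $\hat\sigma\in\{0,1,-1\}^{\mathcal{P}_{i+1}}$ is obtained by deleting the coordinate of $P_i$; for a list $\Sigma'$, $\hat\Sigma'$ is the list of the $\hat\sigma'$. For $\emptyset\neq B=\{b_1,\dots,b_l\}\subset\{0,1,-1\}$ with $b_1\prec\dots\prec b_l$ and $b\in B$, $\Sigma_{b_1\dots b_l}^b$ is the sublist of those $\sigma\in\Sigma$ with $\sigma(P_i)=b$ and $\{b' : \exists\sigma'\in\Sigma,\ \hat\sigma'=\hat\sigma,\ \sigma'(P_i)=b'\}=B$. Write $\Sigma_0,\Sigma_1,\Sigma_{-1}$ for $\Sigma_0^0,\Sigma_1^1,\Sigma_{-1}^{-1}$. For fixed $B$ the list $\hat\Sigma_{b_1\dots b_l}^b$ does not depend on $b\in B$ and is denoted $\hat\Sigma_{b_1\dots b_l}$. Define - $\Sigma_{(1)}$: the merge of $\Sigma_0,\Sigma_1,\Sigma_{-1},\Sigma_{0\,1}^0,\Sigma_{0\,-1}^0,\Sigma_{1\,-1}^{-1},\Sigma_{0\,1\,-1}^0$; - $\Sigma_{(2)}$: the merge of $\Sigma_{0\,1}^1,\Sigma_{0\,-1}^{-1},\Sigma_{1\,-1}^1,\Sigma_{0\,1\,-1}^1$; - $\Sigma_{(3)}=\Sigma_{0\,1\,-1}^{-1}$. Each $\Sigma_{(j)}$ is ordered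 so that $\hat\Sigma_{(j)}$ (which has distinct entries) is lexicographically increasing. For $i<s$, $\Sigma$ is reordered as $\Sigma_{(1)},\Sigma_{(2)},\Sigma_{(3)}$; this only permutes columns of the matrix and entries of $c(\Sigma,Z)$. **Ada and Mat.** $\mathrm{Ada}(\Sigma)$ is the list of $r$ elements of $\{0,1,2\}^{\mathcal{P}_i}$ defined recursively: if $i=s$ it is $0$ when $r=1$; $0,1$ when $r=2$; $0,1,2$ when $r=3$. If $i<s$ it is the concatenation $0\times\mathrm{Ada}(\hat\Sigma_{(1)}),\ 1\times\mathrm{Ada}(\hat\Sigma_{(2)}),\ 2\times\mathrm{Ada}(\hat\Sigma_{(3)})$, where $a\times A$ means prepending the coordinate $a$ (for $P_i$) to each element of $A$. $\mathrm{Ada}$ of an empty list is empty. For a list $A=\alpha_1,\dots,\alpha_{l_1}$ of elements of $\{0,1,2\}^{\mathcal{P}_i}$ and a list $\Sigma'=\sigma'_1,\dots,\sigma'_{l_2}$ of sign conditions for $\mathcal{P}_i$, $\mathrm{Mat}(A,\Sigma')\in\mathbb{Z}^{l_1\times l_2}$ has $(j_1,j_2)$ entry $(\sigma'_{j_2})^{\alpha_{j_1}}$, where $\sigma^\alpha=\prod_{j=i}^s\sigma_j^{\alpha_j}$ and $0^0=1$. $\mathrm{TaQ}(\mathcal{P}_i^{A},Z)$ is the vector with entries $\mathrm{TaQ}(\prod_{j=i}^s P_j^{\alpha_j},Z)$, $\alpha\in A$. It is known that $\mathrm{Mat}(\mathrm{Ada}(\Sigma),\Sigma)$ is an invertible $r\times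 r$ matrix and that the displayed linear system holds. **Algorithm Auxlinsolve.** Input: a list $\Sigma$ of $r$ sign conditions for $\mathcal{P}_i$ and a vector $v\in\mathbb{Q}^r$ indexed by $\mathrm{Ada}(\Sigma)$ (at top level, $v=\mathrm{TaQ}(\mathcal{P}_i^{\mathrm{Ada}(\Sigma)},Z)$). On an empty list it returns the empty vector. For a sublist $\Sigma'$ of $\Sigma$, $c_{\Sigma'}$ denotes the subvector of $c$ at the positions of $\Sigma'$ in $\Sigma=\Sigma_{(1)},\Sigma_{(2)},\Sigma_{(3)}$. 1. If $i=s$, return $\mathrm{Mat}(\mathrm{Ada}(\Sigma),\Sigma)^{-1}v$ (the inverses of the five possible matrices are precomputed). 2. If $i<s$: - 0. $c:=v$. - 1. $c_{\Sigma_{(1)}}:=\text{Auxlinsolve}(\hat\Sigma_{(1)},c_{\Sigma_{(1)}})$. - 2. With $A_2=1\times\mathrm{Ada}(\hat\Sigma_{(2)})$ and $A_3=2\times\mathrm{Ada}(\hat\Sigma_{(3)})$: $c_{\Sigma_{(2)}}:=c_{\Sigma_{(2)}}-\mathrm{Mat}(A_2,\Sigma_1)c_{\Sigma_1}-\mathrm{Mat}(A_2,\Sigma_{-1})c_{\Sigma_{-1}}-\mathrm{Mat}(A_2,\Sigma_{1\,-1}^{-1})c_{\Sigma_{1\,-1}^{-1}}$; $c_{\Sigma_{(3)}}:=c_{\Sigma_{(3)}}-\mathrm{Mat}(A_3,\Sigma_1)c_{\Sigma_1}-\mathrm{Mat}(A_3,\Sigma_{-1})c_{\Sigma_{-1}}-\mathrm{Mat}(A_3,\Sigma_{1\,-1}^{-1})c_{\Sigma_{1\,-1}^{-1}}$.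 - 3. $c_{\Sigma_{(2)}}:=\text{Auxlinsolve}(\hat\Sigma_{(2)},c_{\Sigma_{(2)}})$. - 4. $c_{\Sigma_{0\,-1}^{-1}}:=-c_{\Sigma_{0\,-1}^{-1}}$; $c_{\Sigma_{1\,-1}^1}:=\frac12c_{\Sigma_{1\,-1}^1}$. - 5. $c_{\Sigma_{(3)}}:=c_{\Sigma_{(3)}}-\mathrm{Mat}(A_3,\Sigma_{0\,1}^1)c_{\Sigma_{0\,1}^1}-\mathrm{Mat}(A_3,\Sigma_{0\,-1}^{-1})c_{\Sigma_{0\,-1}^{-1}}-M_3c_{\Sigma_{0\,1\,-1}^1}$, where $M_3=\mathrm{Mat}(\mathrm{Ada}(\hat\Sigma_{(3)}),\hat\Sigma_{(3)})$. - 6. $c_{\Sigma_{(3)}}:=\text{Auxlinsolve}(\hat\Sigma_{(3)},c_{\Sigma_{(3)}})$. - 7. $c_{\Sigma_{(3)}}:=\frac12c_{\Sigma_{(3)}}$. - 8. $c_{\Sigma_{0\,1\,-1}^1}:=c_{\Sigma_{0\,1\,-1}^1}+c_{\Sigma_{(3)}}$. - 9. $c_{\Sigma_{0\,1}^0}:=c_{\Sigma_{0\,1}^0}-c_{\Sigma_{0\,1}^1}$; $c_{\Sigma_{0\,-1}^0}:=c_{\Sigma_{0\,-1}^0}-c_{\Sigma_{0\,-1}^{-1}}$; $c_{\Sigma_{1\,-1}^{-1}}:=c_{\Sigma_{1\,-1}^{-1}}-c_{\Sigma_{1\,-1}^1}$; $c_{\Sigma_{0\,1\,-1}^0}:=c_{\Sigma_{0\,1\,-1}^0}-c_{\Sigma_{0\,1\,-1}^1}-c_{\Sigma_{(3)}}$.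 - 10. Return $c$. **Cost.** One counts arithmetic operations in $\mathbb{Q}$ performed on the vectors; the lists $\Sigma$, $\mathrm{Ada}(\Sigma)$, their sublists, and the matrices $\mathrm{Mat}$ (with entries in $\{0,1,-1\}$) are regarded as available. *)

(* Defs.v *)
From HB Require Import structures.
From mathcomp Require Import all_boot all_order all_algebra.
From mathcomp Require Import finmap mpoly.

Set Implicit Arguments.
Unset Strict Implicit.
Unset Printing Implicit Defensive.

Import Order.TTheory GRing.Theory Num.Theory.
Local Open Scope ring_scope.

(* A sign condition or an exponent for the list P_i, ..., P_s is the sequence
   of its s - i + 1 coordinates, that of P_i being the head. *)
Definition signcond := seq int.
Definition expo := seq nat.

(* The three signs, listed in the order 0 < 1 < -1. *)
Definition signs : seq int := [:: 0; 1; -1].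

Definition is_signcond (n : nat) (sg : signcond) : bool :=
  (size sg == n) && all (mem signs) sg.

Definition sc_le (sg tau : signcond) : bool :=
  ([seq index a signs | a <- sg] <= [seq index a signs | a <- tau]
     :> seqlexi nat)%O.

Definition is_signcond_list (n : nat) (Sg : seq signcond) : bool :=
  [&& all (is_signcond n) Sg, uniq Sg & sorted sc_le Sg].

(* The product of the x_j ^ alpha_j; in particular 0 ^+ 0 = 1. *)
Definition seq_exp (K : comNzRingType) (x : seq K) (alpha : expo) : K :=
  \prod_(j < size x) x`_j ^+ nth 0%N alpha j.

Section Counting.
Variables (R : rcfType) (k : nat).
Implicit Types (P : {mpoly R[k]}) (Ps : seq {mpoly R[k]}) (Z : {fset 'rV[R]_k}).

Definition peval P (x : 'rV[R]_k) : R := P.@[x 0].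

Definition sc_count Ps (sg : signcond) Z : nat :=
  #|` [fset x in Z | [seq sgz (peval P x) | P <- Ps] == sg]%fset |.

Definition feasible Ps (sg : signcond) Z : bool := (0 < sc_count Ps sg Z)%N.

Definition TaQ P Z : int :=
  #|` [fset x in Z | (0 < peval P x)%R]%fset |%:Z
  - #|` [fset x in Z | (peval P x < 0)%R]%fset |%:Z.

Definition sc_count_vec Ps (Sg : seq signcond) Z : seq rat :=
  [seq (sc_count Ps sg Z)%:R | sg <- Sg].

Definition TaQ_vec Ps (A : seq expo) Z : seq rat :=
  [seq (TaQ (seq_exp Ps alpha) Z)%:~R | alpha <- A].

End Counting.

Definition hat (Sg : seq signcond) : seq signcond := [seq behead sg | sg <- Sg].

(* [block Sg B b] is Sigma_B^b; B must be listed in the order of [signs]. *)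
Definition block (Sg : seq signcond) (B : seq int) (b : int) : seq signcond :=
  [seq sg <- Sg | (head 0 sg == b) &&
    ([seq b' <- signs | (b' :: behead sg) \in Sg] == B)].

Definition merge_hat (L : seq (seq signcond)) : seq signcond :=
  sort (fun sg tau => sc_le (behead sg) (behead tau)) (flatten L).

Definition part1 (Sg : seq signcond) : seq signcond :=
  merge_hat [:: block Sg [:: 0] 0; block Sg [:: 1] 1; block Sg [:: -1] (-1);
                block Sg [:: 0; 1] 0; block Sg [:: 0; -1] 0;
                block Sg [:: 1; -1] (-1); block Sg [:: 0; 1; -1] 0].

Definition part2 (Sg : seq signcond) : seq signcond :=
  merge_hat [:: block Sg [:: 0; 1] 1; block Sg [:: 0; -1] (-1);
                block Sg [:: 1; -1] 1; block Sg [:: 0; 1; -1] 1].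

Definition part3 (Sg : seq signcond) : seq signcond :=
  block Sg [:: 0; 1; -1] (-1).

Definition prepend (a : nat) (A : seq expo) : seq expo :=
  [seq a :: alpha | alpha <- A].

(* In [Ada] and [auxlinsolve] the parameter m is s - i. *)
Fixpoint Ada (m : nat) (Sg : seq signcond) : seq expo :=
  if m is m'.+1 then
    prepend 0 (Ada m' (hat (part1 Sg))) ++
    prepend 1 (Ada m' (hat (part2 Sg))) ++
    prepend 2 (Ada m' (hat (part3 Sg)))
  else [seq [:: a] | a <- iota 0 (size Sg)].

Definition Mat (A : seq expo) (Sg : seq signcond) :
    'M[int]_(size A, size Sg) :=
  \matrix_(j1, j2) seq_exp (nth [::] Sg j2) (nth [::] A j1).

Definition MatQ (A : seq expo) (Sg : seq signcond) :
    'M[rat]_(size A, size Sg) := map_mx intr (Mat A Sg).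

Definition seq_col (n : nat) (v : seq rat) : 'cV[rat]_n := \col_j v`_j.

(* A computation is its result together with the number of operations in Q
   that it performs; only the q* primitives have a nonzero cost. *)
Definition comp (T : Type) : Type := (T * nat)%type.
Definition result {T : Type} (e : comp T) : T := e.1.
Definition cost {T : Type} (e : comp T) : nat := e.2.

Definition ret {T : Type} (x : T) : comp T := (x, 0%N).
Definition bind {T U : Type} (e : comp T) (f : T -> comp U) : comp U :=
  let r := f (result e) in (result r, (cost e + cost r)%N).

Notation "x <~ e ;; f" := (bind e (fun x => f))
  (at level 100, e at next level, f at level 200, right associativity).

Definition qadd (x y : rat) : comp rat := (x + y, 1%N).
Definition qsub (x y : rat) : comp rat := (x - y, 1%N).
Definition qmul (x y : rat) : comp rat := (x * y, 1%N).
Definition qopp (x : rat) : comp rat := (- x, 1%N).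

Fixpoint mapM {T U : Type} (f : T -> comp U) (s : seq T) : comp (seq U) :=
  if s is x :: s' then y <~ f x ;; t <~ mapM f s' ;; ret (y :: t)
  else ret [::].

Fixpoint foldlM {T U : Type} (f : U -> T -> comp U) (z : U) (s : seq T) :
    comp U :=
  if s is x :: s' then y <~ f z x ;; foldlM f y s' else ret z.

Definition vopp (c : seq rat) : comp (seq rat) := mapM qopp c.
Definition vhalf (c : seq rat) : comp (seq rat) := mapM (qmul 2^-1) c.
Definition vadd (c d : seq rat) : comp (seq rat) :=
  mapM (fun p => qadd p.1 p.2) (zip c d).
Definition vsub (c d : seq rat) : comp (seq rat) :=
  mapM (fun p => qsub p.1 p.2) (zip c d).

(* c + M d for [op] = [qadd] and c - M d for [op] = [qsub], computed without
   exploiting the values of the entries: products by 0, 1 and -1 are counted,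
   and an m x n matrix costs exactly 2mn operations. *)
Definition gemv (op : rat -> rat -> comp rat) (m n : nat) (M : 'M[rat]_(m, n))
    (d c : seq rat) : comp (seq rat) :=
  mapM (fun j : 'I_m =>
          foldlM (fun acc (l : 'I_n) => t <~ qmul (M j l) d`_l ;; op acc t)
                 c`_j (enum 'I_n))
       (enum 'I_m).

(* The vector c, addressed by sign conditions: [get c L] is the subvector
   c_L, and [upd c L e] is the assignment c_L := e. *)
Definition store := signcond -> rat.

Definition get (c : store) (L : seq signcond) : seq rat := [seq c sg | sg <- L].

Definition upd (c : store) (L : seq signcond) (e : comp (seq rat)) :
    comp store :=
  w <~ e ;;
  ret (fun sg => if sg \in L then w`_(index sg L) else c sg).

Lemma size_Ada0 (Sg : seq signcond) : size (Ada 0 Sg) = size Sg.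
Proof. by rewrite size_map size_iota. Qed.

Definition Mat0 (Sg : seq signcond) : 'M[rat]_(size Sg) :=
  castmx (size_Ada0 Sg, erefl) (MatQ (Ada 0 Sg) Sg).

(* The input v is indexed by [Ada m Sg], hence, position by position, by
   [part1 Sg ++ part2 Sg ++ part3 Sg]. The entries of the output are listed in
   the order of [Sg]; this is what makes the assignment of the output of a
   recursive call on [hat L] to the subvector c_L meaningful. *)
Fixpoint auxlinsolve (m : nat) (Sg : seq signcond) (v : seq rat) :
    comp (seq rat) :=
  if Sg is [::] then ret [::] else
  if m is m'.+1 then
    let S1 := part1 Sg in
    let S2 := part2 Sg in
    let S3 := part3 Sg in
    let A2 := prepend 1 (Ada m' (hat S2)) in
    let A3 := prepend 2 (Ada m' (hat S3)) in
    let M3 := MatQ (Ada m' (hat S3)) (hat S3) in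
    let B1 := block Sg [:: 1] 1 in
    let Bm := block Sg [:: -1] (-1) in
    let B01_0 := block Sg [:: 0; 1] 0 in
    let B01_1 := block Sg [:: 0; 1] 1 in
    let B0m_0 := block Sg [:: 0; -1] 0 in
    let B0m_m := block Sg [:: 0; -1] (-1) in
    let B1m_1 := block Sg [:: 1; -1] 1 in
    let B1m_m := block Sg [:: 1; -1] (-1) in
    let B01m_0 := block Sg [:: 0; 1; -1] 0 in
    let B01m_1 := block Sg [:: 0; 1; -1] 1 in
    (* Step 0 *)
    let c : store := fun sg => v`_(index sg (S1 ++ S2 ++ S3)) in
    (* Step 1 *)
    c <~ upd c S1 (auxlinsolve m' (hat S1) (get c S1)) ;;
    (* Step 2 *)
    c <~ upd c S2 (gemv qsub (MatQ A2 B1) (get c B1) (get c S2)) ;;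
    c <~ upd c S2 (gemv qsub (MatQ A2 Bm) (get c Bm) (get c S2)) ;;
    c <~ upd c S2 (gemv qsub (MatQ A2 B1m_m) (get c B1m_m) (get c S2)) ;;
    c <~ upd c S3 (gemv qsub (MatQ A3 B1) (get c B1) (get c S3)) ;;
    c <~ upd c S3 (gemv qsub (MatQ A3 Bm) (get c Bm) (get c S3)) ;;
    c <~ upd c S3 (gemv qsub (MatQ A3 B1m_m) (get c B1m_m) (get c S3)) ;;
    (* Step 3 *)
    c <~ upd c S2 (auxlinsolve m' (hat S2) (get c S2)) ;;
    (* Step 4 *)
    c <~ upd c B0m_m (vopp (get c B0m_m)) ;;
    c <~ upd c B1m_1 (vhalf (get c B1m_1)) ;;
    (* Step 5 *)
    c <~ upd c S3 (gemv qsub (MatQ A3 B01_1) (get c B01_1) (get c S3)) ;;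
    c <~ upd c S3 (gemv qsub (MatQ A3 B0m_m) (get c B0m_m) (get c S3)) ;;
    c <~ upd c S3 (gemv qsub M3 (get c B01m_1) (get c S3)) ;;
    (* Step 6 *)
    c <~ upd c S3 (auxlinsolve m' (hat S3) (get c S3)) ;;
    (* Step 7 *)
    c <~ upd c S3 (vhalf (get c S3)) ;;
    (* Step 8 *)
    c <~ upd c B01m_1 (vadd (get c B01m_1) (get c S3)) ;;
    (* Step 9 *)
    c <~ upd c B01_0 (vsub (get c B01_0) (get c B01_1)) ;;
    c <~ upd c B0m_0 (vsub (get c B0m_0) (get c B0m_m)) ;;
    c <~ upd c B1m_m (vsub (get c B1m_m) (get c B1m_1)) ;;
    c <~ upd c B01m_0 (vsub (get c B01m_0) (get c B01m_1)) ;;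
    c <~ upd c B01m_0 (vsub (get c B01m_0) (get c S3)) ;;
    (* Step 10 *)
    ret (get c Sg)
  else gemv qadd (invmx (Mat0 Sg)) v (nseq (size Sg) 0).

(* Main.v *)
Require Import Defs.
From HB Require Import structures.
From mathcomp Require Import all_boot all_order all_algebra.
From mathcomp Require Import finmap mpoly.
From mathcomp Require Import zify ring.

(* The cost and the correctness do not depend on the vector c(Sigma, Z) being a
   vector of counts: for arbitrary rational weights x on Sigma, the algorithm
   recovers x from the sums of sigma^alpha x(sigma), alpha in Ada(Sigma). Write
   T_a(tau) for the weight of a :: tau, and 0 if a :: tau is not in Sigma. The
   rows of exponent 0, 1, 2 in P_i are weighted sums over the tails tau of
   T_0 + T_1 + T_{-1}, T_1 - T_{-1} and T_1 + T_{-1}. The first recursive call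
   finds T_0 + T_1 + T_{-1}; subtracting the tails with a single sign, and those
   with signs 1, -1, leaves a system supported on the tails of Sigma_(2), and
   similarly for Sigma_(3), where only 2 T_{-1} survives. For i = s the matrix
   is a Vandermonde matrix in the distinct signs.
   With r_j the size of Sigma_(j), the recursive calls leave
   4 (r1 r2 + r1 r3 + r2 r3) operations for the remaining work. The theorem
   follows because TaQ(Q, Z) is the sum of the signs of Q over Z. *)

Set Implicit Arguments.
Unset Strict Implicit.
Unset Printing Implicit Defensive.

Import Order.TTheory GRing.Theory Num.Theory.
Local Open Scope ring_scope.

(** * Computations with a bounded cost *)

(** A predicate on the result, rather than a value: after an assignment only the entries of the
    store at the relevant sign conditions are known. *)
Definition runs {T : Type} (e : Defs.comp T) (Q : T -> Prop) (n : nat) : Prop :=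
  Q (result e) /\ (cost e <= n)%N.

Lemma runs_bind {T U : Type} (e : Defs.comp T) (f : T -> Defs.comp U)
    (Q : T -> Prop) (Q' : U -> Prop) (n m : nat) :
  runs e Q n -> (forall x, Q x -> runs (f x) Q' m) ->
  runs (bind e f) Q' (n + m).
Proof.
by case=> Qe le_n /(_ _ Qe)[Q'fe le_m]; split=> //; apply: leq_add.
Qed.

Lemma runs_eq {T : Type} (e : Defs.comp T) (x : T) (n : nat) :
  e = (x, n) -> runs e (eq^~ x) n.
Proof. by move=> ->; split. Qed.

Lemma runs_le {T : Type} (e : Defs.comp T) (Q : T -> Prop) (n m : nat) :
  runs e Q n -> (n <= m)%N -> runs e Q m.
Proof. by case=> Qe le_n le_m; split=> //; apply: leq_trans le_m. Qed.

Lemma mapM_const {T U : Type} (f : T -> Defs.comp U) (g : T -> U) (n : nat)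
    (s : seq T) :
  (forall x, f x = (g x, n)) -> mapM f s = ([seq g x | x <- s], (n * size s)%N).
Proof.
move=> fE; elim: s => [|x s IHs] /=; first by rewrite muln0.
by rewrite fE IHs /bind /= addn0 mulnS.
Qed.

Lemma foldlM_const {T U : Type} (f : U -> T -> Defs.comp U) (g : U -> T -> U)
    (n : nat) (z : U) (s : seq T) :
  (forall y x, f y x = (g y x, n)) ->
  foldlM f z s = (foldl g z s, (n * size s)%N).
Proof.
move=> fE; elim: s z => [|x s IHs] z /=; first by rewrite muln0.
by rewrite fE /bind /= IHs /= mulnS.
Qed.

Lemma foldl_bigop {T : Type} (g : T -> rat) (z : rat) (s : seq T) :
  foldl (fun y x => y + g x) z s = z + \sum_(x <- s) g x.
Proof.
by elim: s z => [|x s IHs] z /=; rewrite ?big_nil ?addr0 // IHs big_cons addrA.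
Qed.

Lemma gemv_addE (m n : nat) (M : 'M[rat]_(m, n)) (d c : seq rat) :
  gemv qadd M d c =
    ([seq c`_j + \sum_(l < n) M j l * d`_l | j : 'I_m <- enum 'I_m],
     (2 * (m * n))%N).
Proof.
rewrite /gemv (mapM_const (g := fun j : 'I_m =>
  c`_j + \sum_(l < n) M j l * d`_l) (n := (2 * n)%N)) => [|j].
  by rewrite size_enum_ord mulnAC mulnA.
rewrite (foldlM_const (g := fun y (l : 'I_n) => y + M j l * d`_l) (n := 2)) //.
by rewrite foldl_bigop size_enum_ord big_enum.
Qed.

Lemma gemv_subE (m n : nat) (M : 'M[rat]_(m, n)) (d c : seq rat) :
  gemv qsub M d c =
    ([seq c`_j - \sum_(l < n) M j l * d`_l | j : 'I_m <- enum 'I_m],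
     (2 * (m * n))%N).
Proof.
rewrite /gemv (mapM_const (g := fun j : 'I_m =>
  c`_j - \sum_(l < n) M j l * d`_l) (n := (2 * n)%N)) => [|j].
  by rewrite size_enum_ord mulnAC mulnA.
rewrite (foldlM_const (n := 2)
  (g := fun y (l : 'I_n) => y + - (M j l * d`_l))) //.
by rewrite foldl_bigop size_enum_ord big_enum sumrN.
Qed.

(** * Matrix products and assignments on vectors indexed by sign conditions *)

Local Notation "sg ^Q al" := ((seq_exp sg al)%:~R : rat) (at level 29).

Lemma seq_exp_cons (K : comNzRingType) (a : K) (x : seq K) (b : nat)
    (al : expo) :
  seq_exp (a :: x) (b :: al) = a ^+ b * seq_exp x al.
Proof. by rewrite /seq_exp big_ord_recl. Qed.

Lemma expQ_cons (a : int) (t : signcond) (b : nat) (al : expo) :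
  (a :: t) ^Q (b :: al) = a%:~R ^+ b * t ^Q al.
Proof. by rewrite seq_exp_cons rmorphM rmorphXn. Qed.

(** With vectors written as functions mapped over [A] and [B], the result has the same form as the
    input, so successive subtractions can be chained. *)
Lemma gemv_MatE (A : seq expo) (B : seq signcond) (z : signcond -> rat)
    (y : expo -> rat) :
  gemv qsub (MatQ A B) [seq z sg | sg <- B] [seq y al | al <- A] =
    ([seq y al - \sum_(sg <- B) sg ^Q al * z sg | al <- A],
     (2 * (size A * size B))%N).
Proof.
rewrite gemv_subE; congr pair; apply: (@eq_from_nth _ 0).
  by rewrite [LHS]size_map size_enum_ord size_map.
move=> j; rewrite size_map size_enum_ord => ltjA.
rewrite (nth_map (Ordinal ltjA)) ?size_enum_ord // (nth_map [::]) //.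
have -> : nth (Ordinal ltjA) (enum 'I_(size A)) j = Ordinal ltjA.
  by rewrite (nth_ord_enum _ (Ordinal ltjA)).
rewrite (nth_map [::]) //=; congr (_ - _).
rewrite (big_nth [::]) big_mkord; apply: eq_bigr => l _.
by rewrite !mxE /= (nth_map [::]).
Qed.

Lemma runs_upd (c : store) (L : seq signcond) (e : Defs.comp (seq rat))
    (w : seq rat) (n : nat) :
  uniq L -> size w = size L -> runs e (eq^~ w) n ->
  runs (upd c L e) (fun c' => get c' L = w /\ {in predC (mem L), c' =1 c}) n.
Proof.
move=> L_uniq w_size [ew le_n]; rewrite /upd /bind /ret; split; last first.
  by rewrite /cost /= addn0.
rewrite /result /= -/(result e) ew; split; last first.
  by move=> sg; rewrite inE /= => /negPf ->.
apply: (@eq_from_nth _ 0) => [|j]; rewrite size_map // => ltj.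
by rewrite (nth_map [::]) // mem_nth // index_uniq.
Qed.

Section FamilyUpdate.
Variables (h : signcond -> int) (T : seq signcond).

Lemma mem_cons_map (a : int) (t : signcond) :
  (a :: t \in [seq h u :: u | u <- T]) = (t \in T) && (a == h t).
Proof.
apply/mapP/andP => [[u uT [-> ->]] | [tT /eqP ->]]; first by rewrite eqxx.
by exists t.
Qed.

Lemma cons_map_uniq : uniq T -> uniq [seq h u :: u | u <- T].
Proof. by move=> T_uniq; rewrite map_inj_uniq // => t u []. Qed.

Lemma hat_cons_map : hat [seq h u :: u | u <- T] = T.
Proof. by rewrite /hat -map_comp map_id_in. Qed.

(** The pointwise form of [runs_upd]: it still describes the store when only a part of a known
    subvector is overwritten. *)
Lemma runs_upd_map (c : store) (e : Defs.comp (seq rat)) (f : signcond -> rat)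
    (n : nat) :
  uniq T -> runs e (eq^~ [seq f t | t <- T]) n ->
  runs (upd c [seq h u :: u | u <- T] e)
    (fun c' => forall a t, c' (a :: t) =
       if (t \in T) && (a == h t) then f t else c (a :: t)) n.
Proof.
move=> T_uniq run_e.
have [|[getE frame] le_n] := runs_upd c (cons_map_uniq T_uniq) _ run_e.
  by rewrite !size_map.
split=> // a t; case: ifP => [/andP[tT /eqP ->] | tTn]; last first.
  by apply: frame; rewrite inE /= mem_cons_map tTn.
by move: getE; rewrite /get -map_comp => /eq_in_map/(_ t tT).
Qed.

End FamilyUpdate.

(** * Splitting a list of sign conditions along its tails *)

Lemma sc_le_trans : transitive sc_le.
Proof. by move=> t s u; apply: le_trans. Qed.

Lemma sc_le_total : total sc_le.
Proof. by move=> s t; apply: le_total. Qed.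

Lemma sc_le_cons (a : int) (s t : signcond) :
  sc_le (a :: s) (a :: t) = sc_le s t.
Proof. by rewrite /sc_le /= lexi_cons lexx. Qed.

(** [sc_le] compares positions in [signs], and all integers outside [signs] share the position 3;
    antisymmetry therefore holds only between genuine sign conditions. *)
Lemma sc_le_anti (m : nat) (s t : signcond) :
  is_signcond m s -> is_signcond m t -> sc_le s t && sc_le t s -> s = t.
Proof.
move=> /andP[_ s_signs] /andP[_ t_signs] /le_anti.
elim: s t s_signs t_signs => [|a s IHs] [|b t] //= /andP[a_sign s_signs].
case/andP=> b_sign t_signs [eq_ab eq_st]; congr (_ :: _); last exact: IHs.
by move: a_sign b_sign eq_ab; rewrite !inE => /or3P[]/eqP-> /or3P[]/eqP->.
Qed.

(** This is the set $B$ attached to the tail [t] in the definition of $\Sigma_B^b$, listed in the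
    order of [signs]. *)
Definition fiber (Sg : seq signcond) (t : signcond) : seq int :=
  [seq b <- signs | (b :: t) \in Sg].

Definition tails (Sg : seq signcond) : seq signcond :=
  sort sc_le (undup (hat Sg)).

Definition tails_with (Sg : seq signcond) (B : seq int) : seq signcond :=
  [seq t <- tails Sg | fiber Sg t == B].

Definition tails2 (Sg : seq signcond) : seq signcond :=
  [seq t <- tails Sg | (1 < size (fiber Sg t))%N].

(** The sign that $\Sigma_{(1)}$, respectively $\Sigma_{(2)}$, selects over a tail with fiber [B];
    [head2] is meaningful only when [B] has at least two elements. *)
Definition head1 (B : seq int) : int := if 0 \in B then 0 else last 0 B.
Definition head2 (B : seq int) : int := if 1 \in B then 1 else -1.

Section Decomposition.
Variables (m : nat) (Sg : seq signcond).
Hypothesis Sg_list : is_signcond_list m.+2 Sg.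

Local Notation U := (tails Sg).
Local Notation F := (fiber Sg).
Local Notation T := (tails_with Sg).

Lemma signcond_consP (sg : signcond) :
  sg \in Sg -> [/\ sg = head 0 sg :: behead sg, is_signcond m.+1 (behead sg)
    & head 0 sg \in signs].
Proof.
have /and3P[/allP Sg_sc _ _] := Sg_list.
by case: sg => [|a t] /Sg_sc // /andP[sz /=/andP[? ?]]; split=> //; apply/andP.
Qed.

Lemma mem_fiber (a : int) (t : signcond) : (a \in F t) = (a :: t \in Sg).
Proof.
rewrite mem_filter andbC; case: (boolP (a :: t \in Sg)) => [/signcond_consP|_].
  by case=> _ _ ->.
by rewrite andbF.
Qed.

Lemma fiber_cons (a : int) (t : signcond) :
  a :: t \in Sg -> (t \in U) * (a \in F t).
Proof.
move=> atSg; rewrite mem_fiber mem_sort mem_undup atSg; split=> //.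
exact: (map_f behead atSg).
Qed.

Lemma tails_uniq : uniq U.
Proof. by rewrite sort_uniq undup_uniq. Qed.

Lemma tails_signcond : all (is_signcond m.+1) U.
Proof.
apply/allP=> t; rewrite mem_sort mem_undup => /mapP[sg /signcond_consP[]].
by move=> _ ? _ ->.
Qed.

Lemma tails_sorted : sorted sc_le U.
Proof. exact: sort_sorted sc_le_total _. Qed.

Lemma fiber_neq0 (t : signcond) : t \in U -> F t != [::].
Proof.
rewrite mem_sort mem_undup => /mapP[sg sgSg ->].
have [sgE _ _] := signcond_consP sgSg.
apply/eqP=> F0; move: sgSg; rewrite sgE -mem_fiber F0.
by rewrite in_nil.
Qed.

Lemma filter_tails_list (p : pred signcond) :
  is_signcond_list m.+1 [seq t <- U | p t].
Proof.
apply/and3P; split; last exact/sorted_filter/tails_sorted/sc_le_trans.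
  by apply/allP=> t; rewrite mem_filter => /andP[_ /(allP tails_signcond)].
exact/filter_uniq/tails_uniq.
Qed.

Lemma tails_list : is_signcond_list m.+1 U.
Proof. by have := filter_tails_list predT; rewrite filter_predT. Qed.

(* All the lists of the algorithm have at most one element over each tail, with
   a sign h determined by the fiber of that tail. *)
Lemma section_eq (s : seq signcond) (h : seq int -> int)
    (p : pred (seq int)) :
  uniq s -> sorted (relpre behead sc_le) s ->
  (forall sg, (sg \in s) =
     [&& sg \in Sg, head 0 sg == h (F (behead sg)) & p (F (behead sg))]) ->
  (forall t, t \in U -> p (F t) -> h (F t) \in F t) ->
  s = [seq h (F t) :: t | t <- [seq t <- U | p (F t)]].
Proof.
move=> s_uniq s_sorted s_mem hF.
have sE sg : sg \in s -> sg = h (F (behead sg)) :: behead sg.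
  rewrite s_mem => /and3P[/signcond_consP[sgE _ _] /eqP <- _]; exact: sgE.
have sSg sg : sg \in s -> sg \in Sg by rewrite s_mem => /and3P[].
(* By [sE] an entry of [s] is recovered from its tail, so comparing the tails suffices; both lists
   of tails are sorted without repetition. *)
suff <- : hat s = [seq t <- U | p (F t)].
  rewrite /hat -map_comp -[LHS]map_id; apply/eq_in_map => sg /sE {1}->.
  by [].
have s_hat : perm_eq (hat s) [seq t <- U | p (F t)].
  apply: uniq_perm; rewrite ?filter_uniq ?tails_uniq // ?map_inj_in_uniq //.
    by move=> sg sg' /sE {2}-> /sE {2}-> ->.
  move=> t; rewrite mem_filter; apply/mapP/andP => [[sg sgs ->]|[pt tU]].
    split; first by move: sgs; rewrite s_mem => /and3P[].
    have := sSg _ sgs; rewrite (sE _ sgs) => /fiber_cons[].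
    by [].
  by exists (h (F t) :: t) => //; rewrite s_mem /= eqxx pt -mem_fiber hF.
apply: (sorted_eq_in (leT := sc_le)) s_hat.
- by move=> ? ? ? _ _ _; apply: sc_le_trans.
- move=> t u /mapP[sg /sSg/signcond_consP[_ scg _] ->].
  by move=> /mapP[sg' /sSg/signcond_consP[_ scg' _] ->]; apply: sc_le_anti scg'.
- by rewrite sorted_map.
exact/sorted_filter/tails_sorted/sc_le_trans.
Qed.

Lemma mem_block (B : seq int) (b : int) (sg : signcond) :
  (sg \in block Sg B b) = [&& sg \in Sg, head 0 sg == b & F (behead sg) == B].
Proof. by rewrite mem_filter andbC. Qed.

(** Within a block the head is constantly [b], so the lexicographic order of [Sg] restricts to that
    of the tails. The tails depend on [B] only, not on [b]. *)
Lemma blockE (B : seq int) (b : int) :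
  b \in B -> block Sg B b = [seq b :: t | t <- T B].
Proof.
move=> bB; have /and3P[_ Sg_uniq Sg_sorted] := Sg_list.
apply: (@section_eq _ (fun=> b) (pred1 B)).
- exact: filter_uniq.
- have := sorted_filter sc_le_trans
    (fun sg => (head 0 sg == b) && (F (behead sg) == B)) Sg_sorted.
  rewrite -/(block Sg B b); apply: sub_in_sorted (allss _) => s t.
  rewrite !mem_block => /and3P[/signcond_consP[sE _ _] /eqP sb _].
  move=> /and3P[/signcond_consP[tE _ _] /eqP tb _].
  by rewrite sE tE sb tb sc_le_cons.
- by move=> sg; rewrite mem_block.
by move=> t _ /eqP ->.
Qed.

(** A sign condition determines its head and the fiber of its tail, so distinct pairs give disjoint
    blocks. *)
Lemma perm_blocks (L : seq (seq int * int)) :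
  uniq L ->
  perm_eq (flatten [seq block Sg p.1 p.2 | p <- L])
    [seq sg <- Sg | (F (behead sg), head 0 sg) \in L].
Proof.
elim: L => [_|p L IHL /= /andP[pL /IHL {}IHL]]; first by rewrite filter_pred0.
rewrite perm_sym -(perm_filterC (fun sg => (F (behead sg), head 0 sg) == p)).
rewrite -!filter_predI /=; apply: perm_cat.
  suff -> : block Sg p.1 p.2 =
    [seq sg <- Sg | predI (fun sg => (F (behead sg), head 0 sg) == p)
       (fun sg => (F (behead sg), head 0 sg) \in p :: L) sg] by [].
  apply: eq_filter => sg /=; case: p {pL} => B b.
  rewrite inE /= xpair_eqE andbC andb_orr andbb orb_idr //.
  by case/andP.
rewrite perm_sym; apply: perm_trans IHL _.
set q := predI _ _; suff -> : [seq sg <- Sg | q sg] =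
  [seq sg <- Sg | (F (behead sg), head 0 sg) \in L] by [].
apply: eq_filter => sg; rewrite /q /= inE; case: eqP => [->|] //=.
by rewrite (negPf pL).
Qed.

(** The sets [B] in [L] are distinct, so at most one block contributes over a given tail, and
    sorting by tails leaves no ties. *)
Lemma merge_hatE (L : seq (seq int * int)) (h : seq int -> int) :
  uniq [seq p.1 | p <- L] -> all (fun p => (h p.1 == p.2) && (p.2 \in p.1)) L ->
  merge_hat [seq block Sg p.1 p.2 | p <- L] =
    [seq h (F t) :: t | t <- [seq t <- U | F t \in [seq p.1 | p <- L]]].
Proof.
move=> L_uniq /allP hL; have /and3P[_ Sg_uniq _] := Sg_list.
have blocks := perm_blocks (map_uniq L_uniq).
apply: (@section_eq _ h (mem [seq p.1 | p <- L])).
- by rewrite sort_uniq (perm_uniq blocks) filter_uniq.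
- by apply: sort_sorted => s t; apply: sc_le_total.
- move=> sg; rewrite mem_sort (perm_mem blocks) mem_filter andbC.
  congr andb; apply/idP/andP => [inL|[/eqP -> /mapP[p pL ->]]].
    split; last exact: (map_f fst inL).
    by have /andP[/eqP-> _] := hL _ inL.
  by have /andP[/eqP-> _] := hL _ pL; case: p pL.
by move=> t _ /mapP[p pL ->]; have /andP[/eqP-> ] := hL _ pL.
Qed.

Variant fiber_spec : seq int -> Type :=
  | Fiber_ : fiber_spec [::]
  | Fiber0 : fiber_spec [:: 0]
  | Fiber1 : fiber_spec [:: 1]
  | Fiberm : fiber_spec [:: -1]
  | Fiber01 : fiber_spec [:: 0; 1]
  | Fiber0m : fiber_spec [:: 0; -1]
  | Fiber1m : fiber_spec [:: 1; -1]
  | Fiber01m : fiber_spec [:: 0; 1; -1].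

Lemma fiberP (t : signcond) : fiber_spec (F t).
Proof.
by rewrite /fiber /=; do 3![case: (_ \in Sg)]; constructor.
Qed.

Lemma part1E : part1 Sg = [seq head1 (F t) :: t | t <- U].
Proof.
rewrite [LHS](merge_hatE (L := [:: ([:: 0], 0); ([:: 1], 1); ([:: -1], -1);
  ([:: 0; 1], 0); ([:: 0; -1], 0); ([:: 1; -1], -1); ([:: 0; 1; -1], 0)])
  (h := head1)) //.
congr map; rewrite -[RHS]filter_predT; apply: eq_in_filter => t /fiber_neq0.
by case: fiberP.
Qed.

Lemma part2E :
  part2 Sg = [seq head2 (F t) :: t | t <- tails2 Sg].
Proof.
rewrite [LHS](merge_hatE (L := [:: ([:: 0; 1], 1); ([:: 0; -1], -1);
  ([:: 1; -1], 1); ([:: 0; 1; -1], 1)]) (h := head2)) //.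
by congr map; apply: eq_filter => t; case: fiberP.
Qed.

Lemma part3E : part3 Sg = [seq -1 :: t | t <- T [:: 0; 1; -1]].
Proof. exact: blockE. Qed.

(** Over each tail, [part1] takes one sign of the fiber, [part2] a second one if the fiber has at
    least two, and [part3] the third one if the fiber is full. *)
Lemma perm_parts : perm_eq Sg (part1 Sg ++ part2 Sg ++ part3 Sg).
Proof.
have /and3P[_ Sg_uniq _] := Sg_list.
have nilN (h : signcond -> int) (s : seq signcond) :
  ([::] \in [seq h t :: t | t <- s]) = false by apply/mapP=> -[].
rewrite part1E part2E part3E /tails_with /tails2; apply: uniq_perm => //.
  rewrite !cat_uniq !cons_map_uniq ?filter_uniq ?tails_uniq //= andbT.
  apply/andP; split; apply/hasPn => -[|a t].
  - by rewrite mem_cat !nilN.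
  - rewrite mem_cat !mem_cons_map !mem_filter => atS; apply/negP => /andP[tU].
    move=> /eqP aE; move: atS; rewrite aE tU.
    by case: fiberP.
  - by rewrite !nilN.
  - rewrite !mem_cons_map !mem_filter => /andP[/andP[/eqP -> _] /eqP ->].
    by rewrite andbF.
case=> [|a t]; rewrite !mem_cat.
  by rewrite !nilN; apply/negP => /signcond_consP[].
rewrite !mem_cons_map !mem_filter -mem_fiber.
case: (boolP (t \in U)) => [tU|tUn]; last first.
  rewrite !andbF /= mem_fiber; apply/negP => /fiber_cons[tU _].
  by rewrite tU in tUn.
have := fiber_neq0 tU; case: fiberP => //= _;
  by rewrite !inE; case: (a == 0); case: (a == 1); case: (a == -1).
Qed.

Lemma sum_parts (V : nmodType) (G : signcond -> V) :
  \sum_(sg <- Sg) G sg = \sum_(t <- U) \sum_(a <- F t) G (a :: t).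
Proof.
rewrite (perm_big _ perm_parts) part1E part2E part3E !big_cat !big_map.
rewrite /tails_with /tails2 !big_filter.
rewrite (big_mkcond (fun t => (1 < size (F t))%N)) /=.
rewrite (big_mkcond (fun t => F t == [:: 0; 1; -1])) /= -!big_split /=.
apply: eq_big_seq => t /fiber_neq0; case: fiberP => //= _;
  by rewrite !big_cons !big_nil ?addr0 //= addrC.
Qed.

End Decomposition.

(** The three parts partition [Sg] and passing to tails preserves lengths, so the count follows by
    induction. It gives the row counts in the cost of the matrix products. *)
Lemma size_Ada (m : nat) (Sg : seq signcond) :
  is_signcond_list m.+1 Sg -> size (Ada m Sg) = size Sg.
Proof.
elim: m Sg => [|m IHm] Sg Sg_list /=; first exact: size_Ada0.
have hat1 : is_signcond_list m.+1 (hat (part1 Sg)).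
  by rewrite (part1E Sg_list) hat_cons_map tails_list.
have hat2 : is_signcond_list m.+1 (hat (part2 Sg)).
  by rewrite (part2E Sg_list) hat_cons_map; apply: filter_tails_list.
have hat3 : is_signcond_list m.+1 (hat (part3 Sg)).
  by rewrite (part3E Sg_list) hat_cons_map; apply: filter_tails_list.
rewrite !size_cat !size_map !IHm //.
by rewrite !size_map -!size_cat; apply/esym/perm_size/(perm_parts Sg_list).
Qed.

(** * The linear system and its base case *)

Definition moments (A : seq expo) (Sg : seq signcond) (x : signcond -> rat) :
    seq rat :=
  [seq \sum_(sg <- Sg) sg ^Q al * x sg | al <- A].

Lemma mul_MatQ (A : seq expo) (Sg : seq signcond) (x : signcond -> rat) :
  MatQ A Sg *m seq_col (size Sg) [seq x sg | sg <- Sg] =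
    seq_col (size A) (moments A Sg x).
Proof.
apply/colP => j; rewrite !mxE (nth_map [::]) // (big_nth [::]) big_mkord.
by apply: eq_bigr => l _; rewrite !mxE (nth_map [::]).
Qed.

Lemma Mat0_unit (Sg : seq signcond) :
  is_signcond_list 1 Sg -> Mat0 Sg \in unitmx.
Proof.
case/and3P=> /allP Sg_sc Sg_uniq _.
have sgE (j : 'I_(size Sg)) : nth [::] Sg j = [:: head 0 (nth [::] Sg j)].
  have /andP[] := Sg_sc _ (mem_nth [::] (ltn_ord j)).
  by case: (nth _ _ _) => [|a []].
have -> : Mat0 Sg = Vandermonde (size Sg)
    (\row_(j < size Sg) (head 0 (nth [::] Sg j))%:~R).
  apply/matrixP => i j; rewrite castmxE !mxE /= sgE.
  rewrite (nth_map 0%N) ?size_iota // nth_iota // seq_exp_cons.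
  by rewrite /seq_exp big_ord0 mulr1 rmorphXn.
rewrite unitmxE det_Vandermonde unitfE.
apply/prodf_neq0 => i _; apply/prodf_neq0 => j lt_ij; rewrite !mxE subr_eq0.
rewrite eqr_int; apply: contraTneq lt_ij => eq_head.
(* For $i = s$ a sign condition is its single coordinate, so equal nodes would contradict the
   distinctness of the entries of [Sg]. *)
have /eqP : nth [::] Sg i = nth [::] Sg j by rewrite sgE -eq_head -sgE.
by rewrite nth_uniq // => /eqP ->; rewrite ltnn.
Qed.

(** The dense product with the precomputed inverse costs exactly $2r^2$: the base case uses the
    whole budget. *)
Lemma runs_auxlinsolve0 (Sg : seq signcond) (x : signcond -> rat) :
  is_signcond_list 1 Sg ->
  runs (auxlinsolve 0 Sg (moments (Ada 0 Sg) Sg x))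
    (eq^~ [seq x sg | sg <- Sg]) (2 * size Sg ^ 2).
Proof.
move=> Sg_list; set v := moments _ _ _.
have [-> //|Sg_neq0] := eqVneq Sg [::].
have -> : auxlinsolve 0 Sg v =
    gemv qadd (invmx (Mat0 Sg)) v (nseq (size Sg) 0).
  by case: Sg Sg_neq0 @v {Sg_list}.
apply: runs_eq; rewrite gemv_addE mulnn; congr pair.
have vE : seq_col (size Sg) v = Mat0 Sg *m seq_col _ [seq x sg | sg <- Sg].
  apply/colP => l; have /colP/(_ (cast_ord (esym (size_Ada0 Sg)) l)) :=
    mul_MatQ (Ada 0 Sg) Sg x.
  rewrite -/v !mxE /= => <-; apply: eq_bigr => k _.
  by rewrite castmxE cast_ord_id.
have solE := mulKmx (Mat0_unit Sg_list) (seq_col _ [seq x sg | sg <- Sg]).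
apply: (@eq_from_nth _ 0) => [|j]; rewrite size_map size_enum_ord.
  by rewrite size_map.
move=> ltj; rewrite (nth_map (Ordinal ltj)) ?size_enum_ord //.
have -> : nth (Ordinal ltj) (enum 'I_(size Sg)) j = Ordinal ltj.
  exact: (nth_ord_enum _ (Ordinal ltj)).
rewrite nth_nseq ltj add0r.
move/colP/(_ (Ordinal ltj)): solE; rewrite -vE !mxE /= => <-.
by apply: eq_bigr => l _; rewrite mxE.
Qed.

(** * The recursive step *)

(** Prepending [k] to the exponents and [b] to the sign conditions multiplies the matrix by the
    scalar $b^k$; Steps 2 and 5 can thus be followed on tails. *)
Lemma gemv_prependE (k : nat) (A : seq expo) (b : int) (s : seq signcond)
    (z : signcond -> rat) (y : expo -> rat) :
  gemv qsub (MatQ (prepend k A) [seq b :: t | t <- s]) [seq z t | t <- s]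
      [seq y al | al <- A] =
    ([seq y al - \sum_(t <- s) b%:~R ^+ k * t ^Q al * z t | al <- A],
     (2 * (size A * size s))%N).
Proof.
have -> : [seq z t | t <- s] =
    [seq z (behead sg) | sg <- [seq b :: t | t <- s]].
  by rewrite -map_comp.
have -> : [seq y al | al <- A] = [seq y (behead al) | al <- prepend k A].
  by rewrite -map_comp.
rewrite gemv_MatE !size_map -map_comp; congr pair; apply: eq_map => al /=.
by rewrite big_map; congr (_ - _); apply: eq_bigr => t _; rewrite expQ_cons.
Qed.

Lemma voppE (s : seq signcond) (f : signcond -> rat) :
  vopp [seq f t | t <- s] = ([seq - f t | t <- s], size s).
Proof.
by rewrite /vopp (mapM_const (g := -%R) (n := 1)) // mul1n size_map -map_comp.
Qed.

Lemma vhalfE (s : seq signcond) (f : signcond -> rat) :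
  vhalf [seq f t | t <- s] = ([seq 2^-1 * f t | t <- s], size s).
Proof.
rewrite /vhalf (mapM_const (g := *%R 2^-1) (n := 1)) //.
by rewrite mul1n size_map -map_comp.
Qed.

Lemma vaddE (s : seq signcond) (f g : signcond -> rat) :
  vadd [seq f t | t <- s] [seq g t | t <- s] =
    ([seq f t + g t | t <- s], size s).
Proof.
rewrite /vadd zip_map (mapM_const (g := fun p => p.1 + p.2) (n := 1)) //.
by rewrite mul1n size_map -map_comp.
Qed.

Lemma vsubE (s : seq signcond) (f g : signcond -> rat) :
  vsub [seq f t | t <- s] [seq g t | t <- s] =
    ([seq f t - g t | t <- s], size s).
Proof.
rewrite /vsub zip_map (mapM_const (g := fun p => p.1 - p.2) (n := 1)) //.
by rewrite mul1n size_map -map_comp.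
Qed.

Lemma get_cat (c : store) (L L' : seq signcond) :
  get c (L ++ L') = get c L ++ get c L'.
Proof. exact: map_cat. Qed.

Lemma get_index (v : seq rat) (L : seq signcond) :
  uniq L -> size v = size L -> get (fun sg => v`_(index sg L)) L = v.
Proof.
move=> L_uniq v_size.
apply: (@eq_from_nth _ 0) => [|j]; rewrite size_map // => ltj.
by rewrite (nth_map [::]) // index_uniq.
Qed.

Lemma get_frame (c c' : store) (L L' : seq signcond) :
  {in predC (mem L), c' =1 c} -> ~~ has (mem L) L' -> get c' L' = get c L'.
Proof.
move=> frame /hasPn disj; apply/eq_in_map => sg /disj sgL.
by apply: frame.
Qed.

Lemma get_cons_map (c : store) (h : signcond -> int) (s : seq signcond) :
  get c [seq h t :: t | t <- s] = [seq c (h t :: t) | t <- s].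
Proof. by rewrite /get -map_comp. Qed.

(** * The vector c as three subvectors indexed by tails *)

Section StoreState.
Variables (m : nat) (Sg : seq signcond).
Hypothesis Sg_list : is_signcond_list m.+2 Sg.

Local Notation U := (tails Sg).
Local Notation U2 := (tails2 Sg).
Local Notation F := (fiber Sg).
Local Notation T := (tails_with Sg).
Local Notation U3 := (T [:: 0; 1; -1]).
Local Notation S1 := [seq head1 (F t) :: t | t <- U].
Local Notation S2 := [seq head2 (F t) :: t | t <- U2].
Local Notation S3 := [seq -1 :: t | t <- U3].

Lemma uniq_parts : uniq (S1 ++ S2 ++ S3).
Proof.
rewrite -(part1E Sg_list) -(part2E Sg_list) -(part3E Sg_list).
by rewrite -(perm_uniq (perm_parts Sg_list)); have /and3P[] := Sg_list.
Qed.

Definition state (c : store) (w1 w2 w3 : seq rat) : Prop :=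
  [/\ get c S1 = w1, get c S2 = w2 & get c S3 = w3].

Lemma runs_state1 (c : store) (w1 w2 w3 w : seq rat) (e : Defs.comp (seq rat))
    (n : nat) :
  state c w1 w2 w3 -> size w = size U -> runs e (eq^~ w) n ->
  runs (upd c S1 e) (fun c' => state c' w w2 w3) n.
Proof.
case=> st1 st2 st3 w_size run_e.
have := uniq_parts; rewrite !cat_uniq has_cat negb_or.
case/andP=> U1 /andP[/andP[d12 d13] _].
have [|[gE frame] le_n] := runs_upd c U1 _ run_e; first by rewrite size_map.
by split=> //; split=> //; rewrite (get_frame frame).
Qed.

Lemma runs_state2 (c : store) (w1 w2 w3 w : seq rat) (e : Defs.comp (seq rat))
    (n : nat) :
  state c w1 w2 w3 -> size w = size U2 -> runs e (eq^~ w) n ->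
  runs (upd c S2 e) (fun c' => state c' w1 w w3) n.
Proof.
case=> st1 st2 st3 w_size run_e.
have := uniq_parts; rewrite !cat_uniq has_cat negb_or.
case/andP=> _ /andP[/andP[d12 d13] /and3P[u2 d23 _]].
have [|[gE frame] le_n] := runs_upd c u2 _ run_e; first by rewrite size_map.
split=> //; split=> //; rewrite (get_frame frame) //.
by rewrite has_sym.
Qed.

Lemma runs_state3 (c : store) (w1 w2 w3 w : seq rat) (e : Defs.comp (seq rat))
    (n : nat) :
  state c w1 w2 w3 -> size w = size U3 -> runs e (eq^~ w) n ->
  runs (upd c S3 e) (fun c' => state c' w1 w2 w) n.
Proof.
case=> st1 st2 st3 w_size run_e.
have := uniq_parts; rewrite !cat_uniq has_cat negb_or.
case/andP=> _ /andP[/andP[d12 d13] /and3P[_ d23 u3]].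
have [|[gE frame] le_n] := runs_upd c u3 _ run_e; first by rewrite size_map.
by split=> //; split=> //; rewrite (get_frame frame) // has_sym.
Qed.

Lemma mem_tails2 (t : signcond) : t \in U2 -> t \in U.
Proof. by rewrite mem_filter => /andP[]. Qed.

Lemma mem_tails_with (B : seq int) (t : signcond) :
  t \in T B -> t \in U /\ F t = B.
Proof. by rewrite mem_filter => /andP[/eqP]. Qed.

Lemma head12 (t : signcond) :
  (1 < size (F t))%N -> (head1 (F t) == head2 (F t)) = false.
Proof. by case: fiberP. Qed.

(** Over the tails with fiber [B] the selected sign is constantly [head1 B], so the block is a
    subvector of the first part. *)
Lemma get_block1 (c : store) (w2 w3 : seq rat) (f : signcond -> rat)
    (B : seq int) :
  state c [seq f t | t <- U] w2 w3 ->
  get c [seq head1 B :: t | t <- T B] = [seq f t | t <- T B].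
Proof.
case; rewrite !get_cons_map => /eq_in_map cE _ _; apply/eq_in_map => t.
by case/mem_tails_with=> tU <-; apply: cE.
Qed.

Lemma get_block2 (c : store) (w1 w3 : seq rat) (f : signcond -> rat)
    (B : seq int) :
  (1 < size B)%N -> state c w1 [seq f t | t <- U2] w3 ->
  get c [seq head2 B :: t | t <- T B] = [seq f t | t <- T B].
Proof.
move=> gtB1; case; rewrite !get_cons_map => _ /eq_in_map cE _.
apply/eq_in_map => t /mem_tails_with[tU FtB]; rewrite -FtB; apply: cE.
by rewrite mem_filter FtB gtB1.
Qed.

(** The other parts are untouched: [head1] and [head2] differ on fibers with two or more signs, and
    [head1] is 0 on the full fiber, where the third part uses -1. *)
Lemma runs_block1 (c : store) (w2 w3 : seq rat) (f g : signcond -> rat)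
    (B : seq int) (e : Defs.comp (seq rat)) (n : nat) :
  state c [seq f t | t <- U] w2 w3 -> runs e (eq^~ [seq g t | t <- T B]) n ->
  runs (upd c [seq head1 B :: t | t <- T B] e)
    (fun c' => state c' [seq if F t == B then g t else f t | t <- U] w2 w3) n.
Proof.
case; rewrite !get_cons_map => /eq_in_map st1 st2 st3 run_e.
have [c'E le_n] := runs_upd_map (fun=> head1 B) c
  (filter_uniq _ (tails_uniq Sg)) run_e.
split=> //; split; rewrite !get_cons_map -?st2 -?st3; apply/eq_in_map => t tU;
  rewrite c'E mem_filter.
- rewrite tU andbT; case: eqP => [->|_] /=; first by rewrite eqxx.
  exact: st1.
- have := tU; rewrite mem_filter => /andP[/head12 hF _].
  by case: eqP => //= <-; rewrite eq_sym hF andbF.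
have [_ FE] := mem_tails_with tU.
by case: eqP => //= <-; rewrite FE andbF.
Qed.

Lemma runs_block2 (c : store) (w1 w3 : seq rat) (f g : signcond -> rat)
    (B : seq int) (e : Defs.comp (seq rat)) (n : nat) :
  (1 < size B)%N ->
  state c w1 [seq f t | t <- U2] w3 -> runs e (eq^~ [seq g t | t <- T B]) n ->
  runs (upd c [seq head2 B :: t | t <- T B] e)
    (fun c' => state c' w1 [seq if F t == B then g t else f t | t <- U2] w3) n.
Proof.
move=> gtB1; case; rewrite !get_cons_map => st1 /eq_in_map st2 st3 run_e.
have [c'E le_n] := runs_upd_map (fun=> head2 B) c
  (filter_uniq _ (tails_uniq Sg)) run_e.
split=> //; split; rewrite !get_cons_map -?st1 -?st3; apply/eq_in_map => t tU;
  rewrite c'E mem_filter.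
- case: eqP => //= FtB; rewrite -FtB head12 ?andbF //.
  by rewrite FtB.
- rewrite mem_tails2 // andbT; case: eqP => [->|_] /=; first by rewrite eqxx.
  exact: st2.
have [_ FE] := mem_tails_with tU.
by case: eqP => //= <-; rewrite FE andbF.
Qed.

Lemma sum_tails_with (V : nmodType) (B : seq int) (G : signcond -> V) :
  \sum_(t <- T B) G t = \sum_(t <- U) (if F t == B then G t else 0).
Proof. by rewrite big_filter big_mkcond. Qed.

Lemma sum_tails2 (V : nmodType) (G : signcond -> V) :
  \sum_(t <- U2) G t = \sum_(t <- U) (if (1 < size (F t))%N then G t else 0).
Proof. by rewrite big_filter big_mkcond. Qed.

Lemma size_tails2 :
  size U2 = (size (T [:: 0; 1]%R) + size (T [:: 0; -1]%R)
             + size (T [:: 1; -1]%R) + size U3)%N.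
Proof.
rewrite !size_filter; elim: (tails Sg) => //= t s ->.
by case: fiberP => /=; lia.
Qed.

(** The tails with fiber [[:: 0]] are left out: they enter no matrix product or correction outside
    the recursive call of Step 1. *)
Lemma size_tails_ge :
  (size (T [:: 1]%R) + size (T [:: -1]%R) + size (T [:: 0; 1]%R)
   + size (T [:: 0; -1]%R) + size (T [:: 1; -1]%R) + size U3 <= size U)%N.
Proof.
rewrite !size_filter; elim: (tails Sg) => //= t s IHs.
by case: fiberP => /=; lia.
Qed.

Lemma size_parts : size Sg = (size U + size U2 + size U3)%N.
Proof.
rewrite (perm_size (perm_parts Sg_list)) (part1E Sg_list) (part2E Sg_list).
by rewrite (part3E Sg_list) !size_cat !size_map addnA.
Qed.

End StoreState.

(** The summands follow the order of execution. Outside the recursive calls, the matrix products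
    cost at most $2 r_1 r_2 + 2 r_1 r_3$. The vector operations cost at most $2 r_2 + 2 r_3$, which
    is absorbed by $2 r_1 r_2 + 2 r_2 r_3$ because $r_3 \le r_2 \le r_1$. *)
Lemma step_cost_bound (r1 r2 r3 n1 nm n01 n0m n1m : nat) :
  r2 = (n01 + n0m + n1m + r3)%N ->
  (n1 + nm + n01 + n0m + n1m + r3 <= r1)%N ->
  (2 * r1 ^ 2 + 2 * (r2 * n1) + 2 * (r2 * nm) + 2 * (r2 * n1m)
   + 2 * (r3 * n1) + 2 * (r3 * nm) + 2 * (r3 * n1m) + 2 * r2 ^ 2 + n0m + n1m
   + 2 * (r3 * n01) + 2 * (r3 * n0m) + 2 * (r3 * r3) + 2 * r3 ^ 2 + r3 + r3
   + n01 + n0m + n1m + r3 + r3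
    <= 2 * (r1 + r2 + r3) ^ 2)%N.
Proof.
move=> r2E le_r1.
(* [D] counts the columns of all matrices with rows [A3], and [E] those of all matrices with rows
   [A2]. *)
set D := (n1 + nm + n01 + n0m + n1m + r3)%N in le_r1.
set E := (n1 + nm + n1m)%N.
have h1 : (r2 * E <= r2 * r1)%N by rewrite leq_mul // /E; lia.
have h2 : (r3 * D <= r3 * r1)%N by rewrite leq_mul.
have h3 : (r2 * r2 <= r2 * r1)%N by rewrite leq_mul //; lia.
have h4 : (r2 <= r2 * r2)%N by case: (r2) => // r; rewrite leq_pmulr.
have h5 : (r3 <= r2 * r3)%N.
  by case: (r3) r2E => // r r2E; rewrite leq_pmull //; lia.
have h6 : (n01 + 2 * n0m + 2 * n1m + 4 * r3 <= 2 * r2 + 2 * r3)%N by lia.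
pose sq := (r1 ^ 2 + r2 ^ 2 + r3 ^ 2)%N.
apply: (@leq_trans (2 * (sq + r2 * E + r3 * D)
  + (n01 + 2 * n0m + 2 * n1m + 4 * r3))%N).
  by apply/eq_leq; rewrite /sq /D /E; ring.
apply: (@leq_trans
  (2 * (sq + 2 * (r2 * r1) + 2 * (r3 * r1) + 2 * (r2 * r3)))%N).
  move: h1 h2 h3 h4 h5 h6; move: (r2 * E)%N (r3 * D)%N (r2 * r1)%N (r3 * r1)%N.
  move: (r2 * r3)%N (r2 * r2)%N (n01 + 2 * n0m + 2 * n1m + 4 * r3)%N sq.
  by clear; lia.
by apply/eq_leq; rewrite /sq; ring.
Qed.

(** * Correctness and cost of one level of the recursion *)

Section Step.
Variables (m : nat) (Sg : seq signcond) (x : signcond -> rat).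
Hypothesis Sg_list : is_signcond_list m.+2 Sg.
Hypothesis IHm : forall (Sg' : seq signcond) (x' : signcond -> rat),
  is_signcond_list m.+1 Sg' ->
  runs (auxlinsolve m Sg' (moments (Ada m Sg') Sg' x'))
    (eq^~ [seq x' sg | sg <- Sg']) (2 * size Sg' ^ 2).

Local Notation U := (tails Sg).
Local Notation U2 := (tails2 Sg).
Local Notation F := (fiber Sg).
Local Notation T := (tails_with Sg).
Local Notation U3 := (T [:: 0; 1; -1]).
Local Notation S1 := [seq head1 (F t) :: t | t <- U].
Local Notation S2 := [seq head2 (F t) :: t | t <- U2].
Local Notation S3 := [seq -1 :: t | t <- U3].

Let total (t : signcond) : rat := \sum_(a <- F t) x (a :: t).

(* Solution of the recursive call on [part2]: at a tail t it is the difference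
   x(1 :: t) - x(-1 :: t), except that when t extends exactly by 1 and -1 the
   entry subtracted in Step 2 is x(1 :: t) + x(-1 :: t), which leaves
   2 x(1 :: t). *)
Let signed (t : signcond) : rat :=
  \sum_(a <- F t) a%:~R * x (a :: t)
  + (if F t == [:: 1; -1] then total t else 0).

(* The entries indexed by [part2] after Step 4. *)
Let halved (t : signcond) : rat :=
  if F t == [:: 1; -1]
  then 2^-1 * (if F t == [:: 0; -1] then - signed t else signed t)
  else if F t == [:: 0; -1] then - signed t else signed t.

(** The entry of the input at the exponent [k :: al], regrouped by tails. *)
Let power (k : nat) (al : expo) : rat :=
  \sum_(t <- U) \sum_(a <- F t) a%:~R ^+ k * t ^Q al * x (a :: t).

Let U_list : is_signcond_list m.+1 U.
Proof. exact: tails_list Sg_list. Qed.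

Let U2_list : is_signcond_list m.+1 U2.
Proof. exact: filter_tails_list Sg_list _. Qed.

Let U3_list : is_signcond_list m.+1 U3.
Proof. exact: filter_tails_list Sg_list _. Qed.

(** Regrouping by tails splits the input according to the exponent of $P_i$; for exponent 0 every
    sign contributes with factor 1, as $0^0 = 1$, which gives the moments of [total]. *)
Lemma state0 (c : store) :
  (forall sg,
     c sg = (moments (Ada m.+1 Sg) Sg x)`_(index sg (S1 ++ S2 ++ S3))) ->
  state Sg c (moments (Ada m U) U total) [seq power 1 al | al <- Ada m U2]
    [seq power 2 al | al <- Ada m U3].
Proof.
move=> cE.
have vE : moments (Ada m.+1 Sg) Sg x =
    moments (Ada m U) U total ++ [seq power 1 al | al <- Ada m U2]
      ++ [seq power 2 al | al <- Ada m U3].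
  rewrite /moments /= (part1E Sg_list) (part2E Sg_list) (part3E Sg_list).
  rewrite !hat_cons_map !map_cat -!map_comp; congr (_ ++ (_ ++ _));
    apply: eq_map => al /=; rewrite (sum_parts Sg_list); apply: eq_bigr => t _.
  - by rewrite mulr_sumr; apply: eq_bigr => a _; rewrite expQ_cons mul1r.
  - by apply: eq_bigr => a _; rewrite expQ_cons.
  - by apply: eq_bigr => a _; rewrite expQ_cons.
have szU := size_Ada U_list; have szU2 := size_Ada U2_list.
have szU3 := size_Ada U3_list.
have := get_index (v := moments (Ada m.+1 Sg) Sg x) (uniq_parts Sg_list).
rewrite {1 3}vE !size_cat !size_map szU szU2 szU3 => /(_ erefl).
have -> : get
    (fun sg => (moments (Ada m.+1 Sg) Sg x)`_(index sg (S1 ++ S2 ++ S3)))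
    (S1 ++ S2 ++ S3) = get c (S1 ++ S2 ++ S3).
  by apply: eq_map => sg; rewrite cE.
rewrite !get_cat => /eqP; rewrite !eqseq_cat ?size_map //.
by case/and3P=> /eqP ? /eqP ? /eqP ?; split.
Qed.

(** Checked fiber by fiber: tails with a single sign cancel. What remains is the input of the
    recursive call on [part2], with weights [signed]. *)
Lemma power1E (al : expo) :
  power 1 al - \sum_(t <- T [:: 1]) 1%:~R ^+ 1 * t ^Q al * total t
             - \sum_(t <- T [:: -1]) (-1)%:~R ^+ 1 * t ^Q al * total t
             - \sum_(t <- T [:: 1; -1]) (-1)%:~R ^+ 1 * t ^Q al * total t
  = \sum_(t <- U2) t ^Q al * signed t.
Proof.
rewrite !sum_tails_with sum_tails2 -!sumrB; apply: eq_bigr => t _.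
rewrite /signed /total; case: fiberP => /=;
  rewrite ?big_cons ?big_nil; ring.
Qed.

(** For exponent 2 both nonzero signs count with +1. Everything cancels except on full fibers, where
    subtracting $x_1 - x_{-1}$ from $x_1 + x_{-1}$ leaves $2x_{-1}$. *)
Lemma power2E (al : expo) :
  power 2 al - \sum_(t <- T [:: 1]) 1%:~R ^+ 2 * t ^Q al * total t
             - \sum_(t <- T [:: -1]) (-1)%:~R ^+ 2 * t ^Q al * total t
             - \sum_(t <- T [:: 1; -1]) (-1)%:~R ^+ 2 * t ^Q al * total t
             - \sum_(t <- T [:: 0; 1]) 1%:~R ^+ 2 * t ^Q al * halved t
             - \sum_(t <- T [:: 0; -1]) (-1)%:~R ^+ 2 * t ^Q al * halved t
             - \sum_(t <- U3) t ^Q al * halved t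
  = \sum_(t <- U3) t ^Q al * (2 * x (-1 :: t)).
Proof.
rewrite !sum_tails_with -!sumrB; apply: eq_bigr => t _.
rewrite /halved /signed /total; case: fiberP => /=;
  rewrite ?big_cons ?big_nil; ring.
Qed.

(** The assignments are executed one by one on a [state], the induction hypothesis being used with
    the weights [total], [signed] and $2x_{-1}$; the final state is compared with [x] on each
    fiber. *)
Lemma runs_auxlinsolveS :
  runs (auxlinsolve m.+1 Sg (moments (Ada m.+1 Sg) Sg x))
    (eq^~ [seq x sg | sg <- Sg]) (2 * size Sg ^ 2).
Proof.
have st0 := state0 (fun=> erefl).
have szU := size_Ada U_list; have szU2 := size_Ada U2_list.
have szU3 := size_Ada U3_list.
have p1E := part1E Sg_list; have p2E := part2E Sg_list.
have p3E := part3E Sg_list; have bE := blockE Sg_list.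
have get1 B b c w2 w3 f : head1 B = b -> state Sg c [seq f t | t <- U] w2 w3 ->
    get c [seq b :: t | t <- T B] = [seq f t | t <- T B].
  by move=> <-; apply: get_block1.
have get2 B b c w1 w3 f : head2 B = b -> (1 < size B)%N ->
    state Sg c w1 [seq f t | t <- U2] w3 ->
    get c [seq b :: t | t <- T B] = [seq f t | t <- T B].
  by move=> <-; apply: get_block2.
have get_S1 c w1 w2 w3 : state Sg c w1 w2 w3 -> get c S1 = w1 by case.
have get_S2 c w1 w2 w3 : state Sg c w1 w2 w3 -> get c S2 = w2 by case.
have get_S3 c w1 w2 w3 : state Sg c w1 w2 w3 -> get c S3 = w3 by case.
have gemv2 c w1 w3 y b s d z :
    state Sg c w1 [seq y al | al <- Ada m U2] w3 -> d = [seq z t | t <- s] ->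
    runs (upd c S2 (gemv qsub
        (MatQ (prepend 1 (Ada m U2)) [seq b :: t | t <- s]) d (get c S2)))
      (fun c' => state Sg c' w1
         [seq y al - \sum_(t <- s) b%:~R ^+ 1 * t ^Q al * z t
         | al <- Ada m U2] w3)
      (2 * (size U2 * size s)).
  move=> st ->; rewrite (get_S2 _ _ _ _ st) gemv_prependE szU2.
  by apply: (runs_state2 Sg_list st) (runs_eq erefl); rewrite size_map.
have gemv3 c w1 w2 y b s d z :
    state Sg c w1 w2 [seq y al | al <- Ada m U3] -> d = [seq z t | t <- s] ->
    runs (upd c S3 (gemv qsub
        (MatQ (prepend 2 (Ada m U3)) [seq b :: t | t <- s]) d (get c S3)))
      (fun c' => state Sg c' w1 w2
         [seq y al - \sum_(t <- s) b%:~R ^+ 2 * t ^Q al * z t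
         | al <- Ada m U3])
      (2 * (size U3 * size s)).
  move=> st ->; rewrite (get_S3 _ _ _ _ st) gemv_prependE szU3.
  by apply: (runs_state3 Sg_list st) (runs_eq erefl); rewrite size_map.
have block1 B b c w2 w3 f e g n : head1 B = b ->
    state Sg c [seq f t | t <- U] w2 w3 -> e = ([seq g t | t <- T B], n) ->
    runs (upd c [seq b :: t | t <- T B] e)
      (fun c' =>
         state Sg c' [seq if F t == B then g t else f t | t <- U] w2 w3) n.
  by move=> <- st ->; apply: runs_block1 st (runs_eq erefl).
have block2 B b c w1 w3 f e g n : head2 B = b -> (1 < size B)%N ->
    state Sg c w1 [seq f t | t <- U2] w3 -> e = ([seq g t | t <- T B], n) ->
    runs (upd c [seq b :: t | t <- T B] e)
      (fun c' =>
         state Sg c' w1 [seq if F t == B then g t else f t | t <- U2] w3) n.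
  by move=> <- gtB1 st ->; apply: runs_block2 st (runs_eq erefl).
set v := moments (Ada m.+1 Sg) Sg x in st0 *.
(* The list is tested for emptiness before the recursion on [m]; exposing a cons lets the recursive
   branch reduce. *)
case SgE : {1}Sg => [|sg0 Sg0]; first by rewrite SgE.
lazy iota beta delta [auxlinsolve]; rewrite -/auxlinsolve -SgE.
lazy zeta.
rewrite p1E p2E p3E !bE // !hat_cons_map {sg0 Sg0 SgE}.
(* From here on the store is known only through its [state]. *)
move: {v} (fun sg => _) st0 => c st.
(* The bound is left open and filled in by the operations as they occur; it is compared with $2r^2$
   at the end. *)
apply: runs_le.
  rewrite (get_S1 _ _ _ _ st).
  apply: (runs_bind (runs_state1 Sg_list st _ (IHm total U_list)))
    => [|{st}{}c st]; first by rewrite size_map.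
  apply: (runs_bind (gemv2 _ _ _ _ _ _ _ _ st
    (get1 _ _ _ _ _ _ erefl st))) => {st}{}c st.
  apply: (runs_bind (gemv2 _ _ _ _ _ _ _ _ st
    (get1 _ _ _ _ _ _ erefl st))) => {st}{}c st.
  apply: (runs_bind (gemv2 _ _ _ _ _ _ _ _ st
    (get1 _ _ _ _ _ _ erefl st))) => {st}{}c st.
  apply: (runs_bind (gemv3 _ _ _ _ _ _ _ _ st
    (get1 _ _ _ _ _ _ erefl st))) => {st}{}c st.
  apply: (runs_bind (gemv3 _ _ _ _ _ _ _ _ st
    (get1 _ _ _ _ _ _ erefl st))) => {st}{}c st.
  apply: (runs_bind (gemv3 _ _ _ _ _ _ _ _ st
    (get1 _ _ _ _ _ _ erefl st))) => {st}{}c st.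
  rewrite (get_S2 _ _ _ _ st) (eq_map power1E).
  apply: (runs_bind (runs_state2 Sg_list st _ (IHm signed U2_list)))
    => [|{st}{}c st]; first by rewrite size_map.
  rewrite (get2 _ _ _ _ _ _ _ _ st) // voppE.
  apply: (runs_bind (block2 _ _ _ _ _ _ _ _ _ _ _ st erefl)) => // {st}{}c st.
  rewrite (get2 _ _ _ _ _ _ _ _ st) // vhalfE.
  apply: (runs_bind (block2 _ _ _ _ _ _ _ _ _ _ _ st erefl)) => // {st}{}c st.
  apply: (runs_bind (gemv3 _ _ _ _ _ _ _ _ st
    (get2 [:: 0; 1] 1 _ _ _ _ erefl erefl st))) => {st}{}c st.
  apply: (runs_bind (gemv3 _ _ _ _ _ _ _ _ st
    (get2 [:: 0; -1] (-1) _ _ _ _ erefl erefl st))) => {st}{}c st.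
  (* [M3] has no prepended coordinates, so the unprefixed product formula applies. *)
  rewrite (get2 _ _ _ _ _ _ _ _ st) // (get_S3 _ _ _ _ st) gemv_MatE szU3.
  apply: (runs_bind (runs_state3 Sg_list st _ (runs_eq erefl)))
    => [|{st}{}c st]; first by rewrite size_map.
  rewrite (get_S3 _ _ _ _ st) (eq_map power2E).
  apply: (runs_bind (runs_state3 Sg_list st _
    (IHm (fun t => 2 * x (-1 :: t)) U3_list)))
    => [|{st}{}c st]; first by rewrite size_map.
  rewrite (get_S3 _ _ _ _ st) vhalfE.
  apply: (runs_bind (runs_state3 Sg_list st _ (runs_eq erefl)))
    => [|{st}{}c st]; first by rewrite size_map.
  rewrite (get2 _ _ _ _ _ _ _ _ st) // (get_S3 _ _ _ _ st) vaddE.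
  apply: (runs_bind (block2 _ _ _ _ _ _ _ _ _ _ _ st erefl)) => // {st}{}c st.
  rewrite (get1 _ 0 _ _ _ _ _ st) // (get2 _ _ _ _ _ _ _ _ st) // vsubE.
  apply: (runs_bind (block1 _ _ _ _ _ _ _ _ _ _ st erefl)) => // {st}{}c st.
  rewrite (get1 _ 0 _ _ _ _ _ st) // (get2 _ (-1) _ _ _ _ _ _ st) // vsubE.
  apply: (runs_bind (block1 _ _ _ _ _ _ _ _ _ _ st erefl)) => // {st}{}c st.
  rewrite (get1 _ (-1) _ _ _ _ _ st) // (get2 _ 1 _ _ _ _ _ _ st) // vsubE.
  apply: (runs_bind (block1 _ _ _ _ _ _ _ _ _ _ st erefl)) => // {st}{}c st.
  rewrite (get1 _ 0 _ _ _ _ _ st) // (get2 _ 1 _ _ _ _ _ _ st) // vsubE.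
  apply: (runs_bind (block1 _ _ _ _ _ _ _ _ _ _ st erefl)) => // {st}{}c st.
  rewrite (get1 _ 0 _ _ _ _ _ st) // (get_S3 _ _ _ _ st) vsubE.
  apply: (runs_bind (block1 _ _ _ _ _ _ _ _ _ _ st erefl)) => // {st}{}c st.
  split; last exact: leqnn.
  (* The output follows the order of [Sg], while the state describes the three parts; both lists
     have the same elements. *)
  suff getE : get c (S1 ++ S2 ++ S3) = [seq x sg | sg <- S1 ++ S2 ++ S3].
    apply/eq_in_map => sg; rewrite (perm_mem (perm_parts Sg_list)) p1E p2E p3E.
    by move/eq_in_map: getE; apply.
  case: st; rewrite !get_cat !map_cat => -> -> ->.
  rewrite -!map_comp; congr (_ ++ (_ ++ _)); apply/eq_in_map => t /=.
  (* On the first part, Step 9 has subtracted from [total] the weights of the other signs of the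
     fiber. *)
  - move=> /(fiber_neq0 Sg_list); rewrite /signed /total.
    by case: fiberP => //= _; rewrite ?big_cons ?big_nil /head1 /=; field.
  - rewrite mem_filter /signed /total => /andP[+ _].
    by case: fiberP => //= _; rewrite ?big_cons ?big_nil /head2 /=; field.
  - by move=> _; field.
rewrite (size_parts Sg_list).
move: (size_tails2 Sg_list) (size_tails_ge Sg_list).
move: (size U) (size U2) (size U3) (size (T [:: 1])) (size (T [:: -1]))
  (size (T [:: 0; 1])) (size (T [:: 0; -1])) (size (T [:: 1; -1])).
move=> r1 r2 r3 n1 nm n01 n0m n1m r2E le_r1.
by apply: leq_trans (step_cost_bound r2E le_r1); apply/eq_leq; ring.
Qed.

End Step.

Lemma runs_auxlinsolve (m : nat) (Sg : seq signcond) (x : signcond -> rat) :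
  is_signcond_list m.+1 Sg ->
  runs (auxlinsolve m Sg (moments (Ada m Sg) Sg x))
    (eq^~ [seq x sg | sg <- Sg]) (2 * size Sg ^ 2).
Proof.
elim: m Sg x => [|m IHm] Sg x Sg_list; first exact: runs_auxlinsolve0.
exact: runs_auxlinsolveS.
Qed.

(** * Tarski queries *)

Lemma card_fset_count (K : choiceType) (Z : {fset K}) (p : pred K) :
  #|` [fset z in Z | p z]%fset| = count p Z.
Proof.
rewrite -size_filter; apply: perm_size; apply: uniq_perm => //.
  exact/filter_uniq/fset_uniq.
by move=> z; rewrite !inE mem_filter andbC.
Qed.

Section TarskiQuery.
Variables (R : rcfType) (k : nat).
Implicit Types (P : {mpoly R[k]}) (Ps : seq {mpoly R[k]}) (Z : {fset 'rV[R]_k}).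

Lemma TaQ_sum P Z : TaQ P Z = \sum_(z <- Z) sgz (peval P z).
Proof.
rewrite /TaQ !card_fset_count; elim: (enum_fset Z) => [|z s IHs].
  by rewrite big_nil.
rewrite big_cons -IHs /= /sgz; case: (ltgtP (peval P z) 0) => _ /=; lia.
Qed.

(** Evaluation and sign are both multiplicative. *)
Lemma sgz_seq_exp Ps (al : expo) (z : 'rV[R]_k) :
  sgz (peval (seq_exp Ps al) z) = seq_exp [seq sgz (peval P z) | P <- Ps] al.
Proof.
rewrite /seq_exp /peval rmorph_prod (big_morph _ (@sgzM _) (sgz1 _)) size_map.
by apply: eq_bigr => j _; rewrite rmorphXn sgzX (nth_map 0).
Qed.

(** Each point of [Z] realizes exactly one sign condition, so after exchanging the sums over [Z] and
    [Sg] a single term survives for each point. *)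
Lemma TaQ_vec_moments Ps Z (Sg : seq signcond) (A : seq expo) :
  uniq Sg ->
  (forall sg, is_signcond (size Ps) sg -> feasible Ps sg Z -> sg \in Sg) ->
  TaQ_vec Ps A Z = moments A Sg (fun sg => (sc_count Ps sg Z)%:R).
Proof.
move=> Sg_uniq hfeas; apply: eq_map => al; rewrite TaQ_sum rmorph_sum /=.
pose sgn (z : 'rV[R]_k) := [seq sgz (peval P z) | P <- Ps].
have countE sg : (sc_count Ps sg Z)%:R = \sum_(z <- Z) (sgn z == sg)%:R :> rat.
  by rewrite /sc_count card_fset_count -sum1_count natr_sum [LHS]big_mkcond /=;
    apply: eq_bigr => z _; rewrite /sgn; case: eqP.
under [RHS]eq_bigr => sg _ do rewrite countE mulr_sumr.
rewrite exchange_big /=; apply: eq_big_seq => z zZ.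
(* The realized sign condition is feasible, hence listed in [Sg]. *)
have sgnSg : sgn z \in Sg.
  apply: hfeas.
    rewrite /is_signcond size_map eqxx /=; apply/allP => _ /mapP[P _ ->].
    by rewrite !inE; case: sgzP.
  rewrite /feasible /sc_count card_fset_count -has_count; apply/hasP.
  by exists z => //; apply: eqxx.
rewrite (bigD1_seq _ sgnSg Sg_uniq) /= eqxx mulr1 sgz_seq_exp big1 ?addr0 //.
by move=> sg; rewrite eq_sym => /negPf ->; rewrite mulr0.
Qed.

End TarskiQuery.

Theorem theorem5 (R : rcfType) (k s i : nat) (hi : (1 <= i <= s)%N)
    (P : s.-tuple {mpoly R[k]}) (Z : {fset 'rV[R]_k}) (Sg : seq signcond)
    (hSg : is_signcond_list (s - i).+1 Sg)
    (hfeas : forall sg : signcond, is_signcond (s - i).+1 sg ->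
       feasible (drop i.-1 P) sg Z -> sg \in Sg) :
  let Pi := drop i.-1 P in
  let A := Ada (s - i) Sg in
  let v := TaQ_vec Pi A Z in
  let run := auxlinsolve (s - i) Sg v in
  [/\ result run = sc_count_vec Pi Sg Z,
      MatQ A Sg *m seq_col (size Sg) (result run) = seq_col (size A) v
    & (cost run <= 2 * size Sg ^ 2)%N].
Proof.
move=> Pi A v run.
(* Indices start at 1: dropping $i - 1$ polynomials leaves $s - i + 1$. *)
have szPi : size Pi = (s - i).+1.
  by rewrite size_drop size_tuple; move: hi; clear; lia.
have vE : v = moments A Sg (fun sg => (sc_count Pi sg Z)%:R).
  by apply: TaQ_vec_moments; [case/and3P: hSg | rewrite szPi].
have [resE costE] := runs_auxlinsolve (fun sg => (sc_count Pi sg Z)%:R) hSg.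
rewrite -vE in resE costE.
by split=> //; rewrite resE vE mul_MatQ.
Qed.
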